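(* Let $F: \mathcal{C} \to \mathcal{D}$ be a tensor functor between tensor categories over a field $k$ that has a left adjoint $L$ and a right adjoint $R$ and satisfies the following equivalent conditions: (1) $L$ has a left adjoint; (2) $R$ has a right adjoint; (3) there is an object $\chi_F \in \mathcal{D}$ such that $R \cong L(- \otimes \chi_F)$. Let $\chi_F$ be the relative modular object of $F$. If $\chi = \chi_F$, then there are natural isomorphisms $$L(V \otimes \chi) \cong R(V) \cong L(\chi \otimes V) \quad \text{and} \quad R(\chi^* \otimes V) \cong L(V) \cong R(V \otimes \chi^* )$$ for $V \in \mathcal{D}$. Each of these natural isomorphisms characterizes the relative modular object: namely, if $\chi \in \mathcal{D}$ is an object such that one of these four natural isomorphisms exists, then $\chi \cong \chi_F$.
   Context: $k$ is an arbitrary field. A tensor category is a $k$-linear abelian category endowed with a rigid monoidal structure whose tensor product is $k$-bilinear (the unit object $\mathbf{1}$ is not assumed simple). A tensor functor is a $k$-linear strong monoidal functor between tensor categories. The left dual $X^*$ of $X$ comes with $X^* \otimes X \to \mathbf{1}$ and $\mathbf{1} \to X \otimes X^*$. For $F$ as in the claim, the object $\chi_F$ in condition (3) is unique up to isomorphism and is called the relative modular object of $F$. *)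

(* Defs.v *)
From HB Require Import structures.
From mathcomp Require Import all_boot all_order all_algebra.

Set Implicit Arguments.
Unset Strict Implicit.
Unset Printing Implicit Defensive.

Import GRing.Theory.
Local Open Scope ring_scope.

Declare Scope cat_scope.
Delimit Scope cat_scope with cat.
Local Open Scope cat_scope.

Reserved Notation "g ∘ f" (at level 40, left associativity).
Reserved Notation "X ⊗ Y" (at level 35, right associativity).
Reserved Notation "f ⊠ g" (at level 35, right associativity).

(** * Categories, functors, adjunctions *)

Record category := Category {
  obj :> Type;
  hom : obj -> obj -> Type;
  idm : forall X, hom X X;
  comp : forall X Y Z, hom Y Z -> hom X Y -> hom X Z;
  comp_idl : forall X Y (f : hom X Y), comp (idm Y) f = f;
  comp_idr : forall X Y (f : hom X Y), comp f (idm X) = f;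
  comp_assoc : forall W X Y Z (h : hom Y Z) (g : hom X Y) (f : hom W X),
    comp h (comp g f) = comp (comp h g) f
}.

Notation "g ∘ f" := (comp g f) : cat_scope.

Record iso (C : category) (X Y : C) := Iso {
  iso_hom :> hom X Y;
  iso_inv : hom Y X;
  iso_homK : iso_inv ∘ iso_hom = idm X;
  iso_invK : iso_hom ∘ iso_inv = idm Y
}.

Definition isomorphic (C : category) (X Y : C) : Prop := inhabited (iso X Y).

Record functor (C D : category) := Functor {
  fobj :> C -> D;
  fmap : forall X Y, hom X Y -> hom (fobj X) (fobj Y);
  fmap_id : forall X, fmap (idm X) = idm (fobj X);
  fmap_comp : forall X Y Z (g : hom Y Z) (f : hom X Y),
    fmap (g ∘ f) = fmap g ∘ fmap f
}.


Section Composition.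
Variables (A B C : category) (G : functor B C) (F : functor A B).

Lemma fcomp_id X : fmap G (fmap F (idm X)) = idm (G (F X)).
Proof. by rewrite !fmap_id. Qed.

Lemma fcomp_comp X Y Z (g : hom Y Z) (f : hom X Y) :
  fmap G (fmap F (g ∘ f)) = fmap G (fmap F g) ∘ fmap G (fmap F f).
Proof. by rewrite !fmap_comp. Qed.

Definition fcomp : functor A C :=
  @Functor A C (fun X => G (F X)) (fun X Y f => fmap G (fmap F f))
    fcomp_id fcomp_comp.
End Composition.

Definition nat_isomorphic (C D : category) (F G : functor C D) : Prop :=
  exists eta : forall X, iso (F X) (G X),
    forall X Y (f : hom X Y), eta Y ∘ fmap F f = fmap G f ∘ eta X.

(* [adjunction L R] is the data of an adjunction with [L] left adjoint to [R]. *)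
Record adjunction (C D : category) (L : functor D C) (R : functor C D) :=
  Adjunction {
  adj_unit : forall V : D, hom V (R (L V));
  adj_counit : forall X : C, hom (L (R X)) X;
  adj_unit_nat : forall (V W : D) (f : hom V W),
    adj_unit W ∘ f = fmap R (fmap L f) ∘ adj_unit V;
  adj_counit_nat : forall (X Y : C) (f : hom X Y),
    adj_counit Y ∘ fmap L (fmap R f) = f ∘ adj_counit X;
  adj_triangle_l : forall V : D,
    adj_counit (L V) ∘ fmap L (adj_unit V) = idm (L V);
  adj_triangle_r : forall X : C,
    fmap R (adj_counit X) ∘ adj_unit (R X) = idm (R X)
}.

Definition has_left_adjoint (C D : category) (G : functor C D) : Prop :=
  exists K : functor D C, inhabited (adjunction K G).

Definition has_right_adjoint (C D : category) (G : functor C D) : Prop :=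
  exists K : functor D C, inhabited (adjunction G K).

(** * Linear and abelian categories *)

Record linear_category (k : fieldType) := LinearCategory {
  lobj : Type;
  lhom : lobj -> lobj -> lmodType k;
  lidm : forall X, lhom X X;
  lcomp : forall X Y Z, lhom Y Z -> lhom X Y -> lhom X Z;
  lcomp_idl : forall X Y (f : lhom X Y), lcomp (lidm Y) f = f;
  lcomp_idr : forall X Y (f : lhom X Y), lcomp f (lidm X) = f;
  lcomp_assoc : forall W X Y Z (h : lhom Y Z) (g : lhom X Y) (f : lhom W X),
    lcomp h (lcomp g f) = lcomp (lcomp h g) f;
  lcomp_linearl : forall X Y Z (f : lhom X Y),
    linear (fun g : lhom Y Z => lcomp g f);
  lcomp_linearr : forall X Y Z (g : lhom Y Z),
    linear (fun f : lhom X Y => lcomp g f)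
}.

Definition category_of_linear (k : fieldType) (C : linear_category k) :
    category :=
  @Category (lobj C) (fun X Y => lhom X Y) (@lidm k C) (@lcomp k C)
    (@lcomp_idl k C) (@lcomp_idr k C) (@lcomp_assoc k C).
Coercion category_of_linear : linear_category >-> category.

Section Abelian.
Variables (k : fieldType) (C : linear_category k).

Definition mono (X Y : C) (f : hom X Y) : Prop :=
  forall (T : C) (g h : hom T X), f ∘ g = f ∘ h -> g = h.

Definition epi (X Y : C) (f : hom X Y) : Prop :=
  forall (T : C) (g h : hom Y T), g ∘ f = h ∘ f -> g = h.

Definition is_kernel (X Y K : C) (f : hom X Y) (i : hom K X) : Prop :=
  f ∘ i = (0 : lhom K Y) /\
  forall (T : C) (g : hom T X), f ∘ g = (0 : lhom T Y) ->
    exists! u : hom T K, i ∘ u = g.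

Definition is_cokernel (X Y Q : C) (f : hom X Y) (p : hom Y Q) : Prop :=
  p ∘ f = (0 : lhom X Q) /\
  forall (T : C) (g : hom Y T), g ∘ f = (0 : lhom X T) ->
    exists! u : hom Q T, u ∘ p = g.

Definition is_zero_object (Z : C) : Prop :=
  forall X : C, (exists! f : hom X Z, True) /\ (exists! f : hom Z X, True).

Definition is_biproduct (X Y P : C) (i : hom X P) (j : hom Y P)
    (p : hom P X) (q : hom P Y) : Prop :=
  [/\ p ∘ i = idm X, q ∘ j = idm Y,
      p ∘ j = (0 : lhom Y X), q ∘ i = (0 : lhom X Y) &
      (i ∘ p : lhom P P) + (j ∘ q : lhom P P) = idm P].

Record abelian : Prop := Abelian {
  ab_zero : exists Z : C, is_zero_object Z;
  ab_biproduct : forall X Y : C, exists (P : C) (i : hom X P) (j : hom Y P)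
    (p : hom P X) (q : hom P Y), is_biproduct i j p q;
  ab_kernel : forall (X Y : C) (f : hom X Y),
    exists (K : C) (i : hom K X), is_kernel f i;
  ab_cokernel : forall (X Y : C) (f : hom X Y),
    exists (Q : C) (p : hom Y Q), is_cokernel f p;
  ab_mono_normal : forall (X Y : C) (f : hom X Y), mono f ->
    exists (Z : C) (g : hom Y Z), is_kernel g f;
  ab_epi_normal : forall (X Y : C) (f : hom X Y), epi f ->
    exists (Z : C) (g : hom Z X), is_cokernel g f
}.
End Abelian.

(** * Rigid monoidal categories *)

Record monoidal (C : category) := Monoidal {
  tens : C -> C -> C;
  tensm : forall X X' Y Y' : C,
    hom X X' -> hom Y Y' -> hom (tens X Y) (tens X' Y');
  tensm_id : forall X Y : C, tensm (idm X) (idm Y) = idm (tens X Y);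
  tensm_comp : forall (X X' X'' Y Y' Y'' : C)
    (f' : hom X' X'') (f : hom X X') (g' : hom Y' Y'') (g : hom Y Y'),
    tensm (f' ∘ f) (g' ∘ g) = tensm f' g' ∘ tensm f g;
  unit_obj : C;
  associator : forall X Y Z : C,
    iso (tens (tens X Y) Z) (tens X (tens Y Z));
  lunitor : forall X : C, iso (tens unit_obj X) X;
  runitor : forall X : C, iso (tens X unit_obj) X;
  associator_nat : forall (X X' Y Y' Z Z' : C)
    (f : hom X X') (g : hom Y Y') (h : hom Z Z'),
    associator X' Y' Z' ∘ tensm (tensm f g) h
    = tensm f (tensm g h) ∘ associator X Y Z;
  lunitor_nat : forall (X X' : C) (f : hom X X'),
    lunitor X' ∘ tensm (idm unit_obj) f = f ∘ lunitor X;
  runitor_nat : forall (X X' : C) (f : hom X X'),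
    runitor X' ∘ tensm f (idm unit_obj) = f ∘ runitor X;
  pentagon : forall W X Y Z : C,
    associator W X (tens Y Z) ∘ associator (tens W X) Y Z
    = tensm (idm W) (associator X Y Z) ∘
      associator W (tens X Y) Z ∘ tensm (associator W X Y) (idm Z);
  triangle : forall X Y : C,
    tensm (idm X) (lunitor Y) ∘ associator X unit_obj Y
    = tensm (runitor X) (idm Y)
}.

Arguments unit_obj {C} m.
Local Notation "X ⊗ Y" := (tens _ X Y) : cat_scope.
Local Notation "f ⊠ g" := (tensm _ f g) : cat_scope.

(* A duality between [A] and [B], with [A] left dual to [B]
   (equivalently, [B] right dual to [A]). *)
Record duality (C : category) (M : monoidal C) (A B : C) := Duality {
  ev : hom (tens M A B) (unit_obj M);
  coev : hom (unit_obj M) (tens M B A);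
  duality_zigzag_right :
    runitor M B ∘ (idm B ⊠ ev) ∘ associator M B A B ∘
      (coev ⊠ idm B) ∘ iso_inv (lunitor M B) = idm B;
  duality_zigzag_left :
    lunitor M A ∘ (ev ⊠ idm A) ∘ iso_inv (associator M A B A) ∘
      (idm A ⊠ coev) ∘ iso_inv (runitor M A) = idm A
}.

Record rigid (C : category) (M : monoidal C) := Rigid {
  left_dual : C -> C;
  left_duality : forall X : C, duality M (left_dual X) X;
  right_dual : C -> C;
  right_duality : forall X : C, duality M X (right_dual X)
}.

(** * Tensor categories and tensor functors *)

Record tensor_category (k : fieldType) := TensorCategory {
  tc_linear :> linear_category k;
  tc_abelian : abelian tc_linear;
  tc_monoidal : monoidal tc_linear;
  tc_tensm_linearl : forall (X X' Y Y' : tc_linear) (g : lhom Y Y'),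
    linear (fun f : lhom X X' => tensm tc_monoidal f g : lhom _ _);
  tc_tensm_linearr : forall (X X' Y Y' : tc_linear) (f : lhom X X'),
    linear (fun g : lhom Y Y' => tensm tc_monoidal f g : lhom _ _);
  tc_rigid : rigid tc_monoidal
}.

Notation "X ⊗ Y" := (tens (tc_monoidal _) X Y) : cat_scope.
Notation "f ⊠ g" := (tensm (tc_monoidal _) f g) : cat_scope.
Notation "X ^*" := (left_dual (tc_rigid _) X) : cat_scope.

Record tensor_functor (k : fieldType) (C D : tensor_category k) :=
  TensorFunctor {
  tf_functor :> functor C D;
  tf_linear : forall X Y : C,
    linear (fun f : lhom X Y => fmap tf_functor f : lhom _ _);
  tf_mul : forall X Y : C,
    iso (tf_functor X ⊗ tf_functor Y) (tf_functor (X ⊗ Y));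
  tf_unit : iso (unit_obj (tc_monoidal D))
    (tf_functor (unit_obj (tc_monoidal C)));
  tf_mul_nat : forall (X X' Y Y' : C) (f : hom X X') (g : hom Y Y'),
    tf_mul X' Y' ∘ (fmap tf_functor f ⊠ fmap tf_functor g)
    = fmap tf_functor (f ⊠ g) ∘ tf_mul X Y;
  tf_mul_assoc : forall X Y Z : C,
    fmap tf_functor (associator (tc_monoidal C) X Y Z) ∘
      tf_mul (X ⊗ Y) Z ∘ (tf_mul X Y ⊠ idm (tf_functor Z))
    = tf_mul X (Y ⊗ Z) ∘ (idm (tf_functor X) ⊠ tf_mul Y Z) ∘
      associator (tc_monoidal D) (tf_functor X) (tf_functor Y) (tf_functor Z);
  tf_mul_unitl : forall X : C,
    fmap tf_functor (lunitor (tc_monoidal C) X) ∘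
      tf_mul (unit_obj (tc_monoidal C)) X ∘ (tf_unit ⊠ idm (tf_functor X))
    = lunitor (tc_monoidal D) (tf_functor X);
  tf_mul_unitr : forall X : C,
    fmap tf_functor (runitor (tc_monoidal C) X) ∘
      tf_mul X (unit_obj (tc_monoidal C)) ∘ (idm (tf_functor X) ⊠ tf_unit)
    = runitor (tc_monoidal D) (tf_functor X)
}.

Section TensorWith.
Variables (k : fieldType) (D : tensor_category k) (A : D).

Lemma tensr_id (V : D) : idm V ⊠ idm A = idm (V ⊗ A).
Proof. exact: tensm_id. Qed.

Lemma tensr_comp (U V W : D) (g : hom V W) (f : hom U V) :
  (g ∘ f) ⊠ idm A = (g ⊠ idm A) ∘ (f ⊠ idm A).
Proof. by rewrite -tensm_comp comp_idl. Qed.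

Lemma tensl_id (V : D) : idm A ⊠ idm V = idm (A ⊗ V).
Proof. exact: tensm_id. Qed.

Lemma tensl_comp (U V W : D) (g : hom V W) (f : hom U V) :
  idm A ⊠ (g ∘ f) = (idm A ⊠ g) ∘ (idm A ⊠ f).
Proof. by rewrite -tensm_comp comp_idl. Qed.

(* The functors [- ⊗ A] and [A ⊗ -]. *)
Definition tensr : functor D D :=
  @Functor D D (fun V => V ⊗ A) (fun V W f => f ⊠ idm A) tensr_id tensr_comp.

Definition tensl : functor D D :=
  @Functor D D (fun V => A ⊗ V) (fun V W f => idm A ⊠ f) tensl_id tensl_comp.
End TensorWith.

(* [L] and [R] are the left and right adjoints of a tensor functor. *)
Definition is_relative_modular_object (k : fieldType) (C D : tensor_category k)
    (L R : functor D C) (chi : D) : Prop :=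
  nat_isomorphic R (fcomp L (tensr chi)).

(* Main.v *)
Require Import Defs.
From mathcomp Require Import all_boot all_order all_algebra.
Import Defs.

Set Implicit Arguments.
Unset Strict Implicit.
Unset Printing Implicit Defensive.

Local Open Scope cat_scope.

(** Write `X and X' for the left and the right dual of X, and 1 for the unit.
    Rigidity makes L and R compatible with tensoring by objects of C, in two
    ways that carry the proof: the projection formula R(V) ⊗ Y ≅ R(V ⊗ F Y)
    ([proj_iso]), and the formula L(V) ≅ `(R(V')) ([left_as_dual]).

    Suppose that the functor V |-> Hom(R(V), 1) is represented by an object G
    of D.  Each of the three conditions on F provides such a G: the right
    adjoint of R evaluated at 1; the object F(1) ⊗ `χ when R ≅ L(- ⊗ χ); and
    if L has a left adjoint, the first case in the opposite categories yields
    R ≅ L(- ⊗ χ), which is the second case.  By the projection formula,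
      Hom(R(V), X) ≅ Hom(R(V) ⊗ X', 1) ≅ Hom(R(V ⊗ F X'), 1)
        ≅ Hom(V ⊗ F X', G) ≅ Hom(V, G ⊗ F X) ≅ Hom(L(`G ⊗ V), X),
    whence R ≅ L(`G ⊗ -), and R ≅ L(- ⊗ G') by the mirror image of this
    computation ([right_from_left]).  Dualizing through L(V) ≅ `(R(V')) turns
    these into L ≅ R(- ⊗ G) and L ≅ R(G ⊗ -) ([left_from_right]).

    The functor L(- ⊗ A) determines A, because Hom(L(V ⊗ A), 1) is naturally
    Hom(V, `A) ([left_rtens_inj]).  Composing the four isomorphisms therefore
    gives G ⊗ G' ≅ 1 and `G ⊗ G ≅ 1, so that `G ≅ G'.  Both are isomorphic to
    the relative modular object χ, and G ≅ `χ: the four isomorphisms become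
    those of the proposition, and the injectivity statement, together with
    its mirror image and its opposites, shows that each of them determines χ.

    Everything is obtained from the Yoneda lemma applied to chains of natural
    bijections.  Passing to the opposite category exchanges L with R, and
    reversing the tensor product exchanges left with right duals; both
    symmetries are used throughout to halve the work. *)

(** * Rigid categories and their symmetries *)

Record rcat := RCat {
  rc_cat :> category;
  rc_mon : monoidal rc_cat;
  rc_rigid : rigid rc_mon
}.

Local Notation "X ⊗ Y" := (tens (rc_mon _) X Y) : cat_scope.
Local Notation "f ⊠ g" := (tensm (rc_mon _) f g) : cat_scope.
Local Notation one C := (unit_obj (rc_mon C)).
Local Notation alpha := (associator (rc_mon _)).
Local Notation lam := (lunitor (rc_mon _)).
Local Notation rho := (runitor (rc_mon _)).
Local Notation dual := (duality (rc_mon _)).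

Lemma comp_rewrite (C : category) (W X Y Z : C) (a : hom Y Z) (b : hom X Y)
    (c : hom X Z) : a ∘ b = c -> forall x : hom Z W, x ∘ a ∘ b = x ∘ c.
Proof. by move=> <- x; rewrite comp_assoc. Qed.

Lemma iso_cancell (C : category) (X Y Z : C) (i : iso Y Z) (f g : hom X Y) :
  i ∘ f = i ∘ g -> f = g.
Proof.
move=> E; rewrite -(comp_idl f) -(comp_idl g) -(iso_homK i) -!comp_assoc.
by rewrite E.
Qed.

Lemma iso_cancelr (C : category) (X Y Z : C) (i : iso X Y) (f g : hom Y Z) :
  f ∘ i = g ∘ i -> f = g.
Proof.
move=> E; rewrite -(comp_idr f) -(comp_idr g) -(iso_invK i) !comp_assoc.
by rewrite E.
Qed.

Definition iso_sym (C : category) (X Y : C) (i : iso X Y) : iso Y X :=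
  Iso (iso_invK i) (iso_homK i).

Lemma iso_square_inv (C : category) (X Y X' Y' : C) (i : iso X Y) (j : iso X' Y')
    (f : hom X X') (g : hom Y Y') :
  j ∘ f = g ∘ i -> iso_inv j ∘ g = f ∘ iso_inv i.
Proof.
move=> E; apply: (@iso_cancelr _ _ _ _ i).
apply: (@iso_cancell _ _ _ _ j).
rewrite (_ : j ∘ (iso_inv j ∘ g ∘ i) = g ∘ i); last first.
  by rewrite !comp_assoc iso_invK comp_idl.
by rewrite -(comp_assoc f) iso_homK comp_idr E.
Qed.

Definition iso_id (C : category) (X : C) : iso X X :=
  Iso (comp_idl (idm X)) (comp_idl (idm X)).

Definition iso_comp (C : category) (X Y Z : C) (j : iso Y Z) (i : iso X Y) :
  iso X Z.
Proof.
exists (j ∘ i) (iso_inv i ∘ iso_inv j).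
- by rewrite !comp_assoc (comp_rewrite (iso_homK j)) comp_idr iso_homK.
- by rewrite !comp_assoc (comp_rewrite (iso_invK i)) comp_idr iso_invK.
Defined.

Definition iso_tens (C : category) (M : monoidal C) (X Y X' Y' : C)
    (i : iso X X') (j : iso Y Y') : iso (tens M X Y) (tens M X' Y').
Proof.
exists (tensm M i j) (tensm M (iso_inv i) (iso_inv j)).
- by rewrite -tensm_comp !iso_homK tensm_id.
- by rewrite -tensm_comp !iso_invK tensm_id.
Defined.

Definition iso_fmap (C D : category) (F : functor C D) (X Y : C)
  (i : iso X Y) : iso (F X) (F Y).
Proof.
exists (fmap F i) (fmap F (iso_inv i)).
- by rewrite -fmap_comp iso_homK fmap_id.
- by rewrite -fmap_comp iso_invK fmap_id.
Defined.

(** Coherence axioms for the opposite and the reversed structures are equations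
    between inverses; this reduces them to the original axioms. *)
Lemma iso_inv_eq (C : category) (X Y : C) (i j : iso X Y) :
  iso_hom i = iso_hom j -> iso_inv i = iso_inv j.
Proof.
move=> E; apply: (@iso_cancelr _ _ _ _ i).
by rewrite iso_homK E iso_homK.
Qed.

Lemma isomorphic_sym (C : category) (X Y : C) :
  isomorphic X Y -> isomorphic Y X.
Proof. by case=> i; constructor; apply: iso_sym. Qed.

Lemma isomorphic_trans (C : category) (X Y Z : C) :
  isomorphic X Y -> isomorphic Y Z -> isomorphic X Z.
Proof. by case=> i [j]; constructor; apply: iso_comp j i. Qed.

Lemma nat_sym (C D : category) (A B : functor C D) :
  nat_isomorphic A B -> nat_isomorphic B A.
Proof.
case=> e e_nat; exists (fun V => iso_sym (e V)) => V W f.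
exact: iso_square_inv.
Qed.

Lemma nat_trans (C D : category) (A B E : functor C D) :
  nat_isomorphic A B -> nat_isomorphic B E -> nat_isomorphic A E.
Proof.
case=> e e_nat [g g_nat]; exists (fun V => iso_comp (g V) (e V)) => V W f /=.
by rewrite -comp_assoc e_nat !comp_assoc g_nat.
Qed.

Lemma nat_whisker (B C D : category) (G G' : functor C D) (H : functor B C) :
  nat_isomorphic G G' -> nat_isomorphic (fcomp G H) (fcomp G' H).
Proof. by case=> e e_nat; exists (fun V => e (H V)) => V W f; apply: e_nat. Qed.

(** All fields are transported as they stand, so that statements about the
    opposite category unfold by conversion to statements about C. *)
Definition op (C : category) : category :=
  @Category C (fun X Y => hom Y X) (@idm C) (fun X Y Z g f => f ∘ g)
    (fun X Y f => comp_idr f) (fun X Y f => comp_idl f)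
    (fun W X Y Z h g f => esym (comp_assoc f g h)).

Definition op_iso (C : category) (X Y : C) (i : iso X Y) : @iso (op C) X Y :=
  @Iso (op C) X Y (iso_inv i) (iso_hom i) (iso_homK i) (iso_invK i).

Definition unop_iso (C : category) (X Y : C) (i : @iso (op C) X Y) :
  iso X Y := @Iso C X Y (iso_inv i) (iso_hom i) (iso_homK i) (iso_invK i).

Definition op_functor (C D : category) (F : functor C D) :
    functor (op C) (op D) :=
  @Functor (op C) (op D) F (fun X Y f => fmap F f) (@fmap_id _ _ F)
    (fun X Y Z g f => fmap_comp F f g).

Definition op_adjunction (C D : category) (L : functor D C) (R : functor C D)
    (a : adjunction L R) : adjunction (op_functor R) (op_functor L).
Proof.
refine (@Adjunction (op D) (op C) (op_functor R) (op_functor L)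
  (adj_counit a) (adj_unit a) _ _ _ _) => /=.
- by move=> V W f; rewrite (adj_counit_nat a).
- by move=> V W f; rewrite (adj_unit_nat a).
- exact: adj_triangle_r.
- exact: adj_triangle_l.
Defined.

Section OpRev.
Variables (C : category) (M : monoidal C).

Definition op_monoidal : monoidal (op C).
Proof.
refine (@Monoidal (op C) (tens M) (fun _ _ _ _ f g => tensm M f g)
  (@tensm_id _ M) (fun X X' X'' Y Y' Y'' f' f g' g => tensm_comp M f f' g g')
  (unit_obj M)
  (fun X Y Z => op_iso (associator M X Y Z)) (fun X => op_iso (lunitor M X))
  (fun X => op_iso (runitor M X)) _ _ _ _ _) => /=.
- move=> X X' Y Y' Z Z' f g h; apply/esym.
  exact/iso_square_inv/associator_nat.
- by move=> X X' f; apply/esym/iso_square_inv/lunitor_nat.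
- by move=> X X' f; apply/esym/iso_square_inv/runitor_nat.
- move=> W X Y Z.
  exact: (@iso_inv_eq _ _ _
    (iso_comp (associator M W X (tens M Y Z)) (associator M (tens M W X) Y Z))
    (iso_comp (iso_comp (iso_tens M (iso_id W) (associator M X Y Z))
       (associator M W (tens M X Y) Z))
       (iso_tens M (associator M W X Y) (iso_id Z))) (pentagon _ _ _ _ _)).
- move=> X Y.
  exact: (@iso_inv_eq _ _ _
    (iso_comp (iso_tens M (iso_id X) (lunitor M Y)) (associator M X _ Y))
    (iso_tens M (runitor M X) (iso_id Y)) (triangle _ _ _)).
Defined.

Definition rev_monoidal : monoidal C.
Proof.
refine (@Monoidal C (fun X Y => tens M Y X) (fun _ _ _ _ f g => tensm M g f)
  (fun X Y => tensm_id M Y X)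
  (fun X X' X'' Y Y' Y'' f' f g' g => tensm_comp M g' g f' f) (unit_obj M)
  (fun X Y Z => iso_sym (associator M Z Y X)) (runitor M) (lunitor M)
  _ _ _ _ _) => /=.
- by move=> X X' Y Y' Z Z' f g h; exact/iso_square_inv/associator_nat.
- exact: runitor_nat.
- exact: lunitor_nat.
- move=> W X Y Z; rewrite -comp_assoc.
  exact: (@iso_inv_eq _ _ _
    (iso_comp (associator M Z Y (tens M X W)) (associator M (tens M Z Y) X W))
    (iso_comp (iso_comp (iso_tens M (iso_id Z) (associator M Y X W))
       (associator M Z (tens M Y X) W))
       (iso_tens M (associator M Z Y X) (iso_id W))) (pentagon _ _ _ _ _)).
- by move=> X Y; rewrite -triangle -comp_assoc iso_invK comp_idr.
Defined.

End OpRev.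

(** Reversing arrows swaps evaluation and coevaluation, reversing the tensor
    product swaps the factors; either way the two zigzags are exchanged. *)
Definition op_duality (C : category) (M : monoidal C) (A B : C)
    (d : duality M A B) : duality (op_monoidal M) B A.
Proof.
refine (@Duality (op C) (op_monoidal M) B A (coev d) (ev d) _ _) => /=.
- by rewrite !comp_assoc duality_zigzag_left.
- by rewrite !comp_assoc duality_zigzag_right.
Defined.

Definition rev_duality (C : category) (M : monoidal C) (A B : C)
    (d : duality M A B) : duality (rev_monoidal M) B A.
Proof.
refine (@Duality C (rev_monoidal M) B A (ev d) (coev d) _ _) => /=.
- by rewrite duality_zigzag_left.
- by rewrite duality_zigzag_right.
Defined.

Definition op_rcat (C : rcat) : rcat := RCat
  (@Rigid (op C) (op_monoidal (rc_mon C))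
    (right_dual (rc_rigid C))
    (fun X => op_duality (right_duality (rc_rigid C) X))
    (left_dual (rc_rigid C))
    (fun X => op_duality (left_duality (rc_rigid C) X))).

Definition rev_rcat (C : rcat) : rcat := RCat
  (@Rigid C (rev_monoidal (rc_mon C))
    (right_dual (rc_rigid C))
    (fun X => rev_duality (right_duality (rc_rigid C) X))
    (left_dual (rc_rigid C))
    (fun X => rev_duality (left_duality (rc_rigid C) X))).

(** * Coherence *)

Section Coherence.
Variable C : rcat.
Implicit Types X Y Z : C.

Lemma runitor_faithful X Y (f g : hom X Y) :
  f ⊠ idm (one C) = g ⊠ idm (one C) -> f = g.
Proof.
move=> E; apply: (@iso_cancelr _ _ _ _ (rho X)).
by rewrite -!runitor_nat E.
Qed.

(** Kelly's argument: tensor on the right with the unit, where the pentagon and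
    the triangle apply. *)
Lemma runitor_tens X Y :
  iso_hom (rho (X ⊗ Y)) = (idm X ⊠ rho Y) ∘ alpha X Y (one C).
Proof.
apply: runitor_faithful; apply: (@iso_cancell _ _ _ _ (alpha X Y (one C))).
rewrite -triangle -tensm_id comp_assoc associator_nat.
rewrite (comp_rewrite (pentagon _ _ _ _ _)) !comp_assoc.
rewrite -!tensm_comp triangle !comp_idl -associator_nat -comp_assoc.
by rewrite -tensm_comp comp_idl.
Qed.

Lemma triangle_inv X Y :
  alpha X (one C) Y ∘ (iso_inv (rho X) ⊠ idm Y) = idm X ⊠ iso_inv (lam Y).
Proof.
apply: (@iso_cancell _ _ _ _ (iso_tens (rc_mon C) (iso_id X) (lam Y))) => /=.
rewrite comp_assoc triangle -!tensm_comp !iso_invK.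
by rewrite !comp_idl.
Qed.
End Coherence.

Lemma lunitor_tens (C : rcat) (X Y : C) :
  lam (X ⊗ Y) ∘ alpha (one C) X Y = lam X ⊠ idm Y.
Proof.
have /= -> := @runitor_tens (rev_rcat C) Y X.
by rewrite -comp_assoc iso_homK comp_idr.
Qed.

Lemma unitor_one (C : rcat) : iso_hom (lam (one C)) = rho (one C).
Proof.
apply: runitor_faithful; rewrite -triangle -lunitor_tens.
congr (_ ∘ _); apply: (@iso_cancell _ _ _ _ (lam (one C))).
by rewrite lunitor_nat.
Qed.

(** * Bijections of hom-sets and their naturality *)

(** An explicit inverse, rather than bijectivity, lets chains of bijections be
    traversed in both directions. *)
Record bij (P Q : Type) := Bij {
  fwd :> P -> Q;
  bwd : Q -> P;
  fwdK : forall x, bwd (fwd x) = x;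
  bwdK : forall x, fwd (bwd x) = x
}.

Definition bsym (P Q : Type) (b : bij P Q) : bij Q P :=
  Bij (bwdK b) (fwdK b).

Definition bcomp (P Q S : Type) (b : bij P Q) (c : bij Q S) : bij P S.
Proof.
exists (fun x => c (b x)) (fun x => bwd b (bwd c x)) => x.
- by rewrite !fwdK.
- by rewrite !bwdK.
Defined.

Infix ";;" := bcomp (at level 50, left associativity).

(** A bijection is natural when it forms commuting squares with the actions of
    morphisms on its source and target.  Stating naturality for one pair of
    actions at a time makes it compose along a chain by [square_comp], and
    spares functors and profunctors for variables that only enter through a
    chosen dual. *)
Definition square (P Q P' Q' : Type) (b : bij P Q) (b' : bij P' Q')
    (p : P -> P') (q : Q -> Q') : Prop :=
  forall x, b' (p x) = q (b x).

Lemma square_comp (P Q S P' Q' S' : Type) (b : bij P Q) (c : bij Q S)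
    (b' : bij P' Q') (c' : bij Q' S') p q s :
  square b b' p q -> square c c' q s -> square (b ;; c) (b' ;; c') p s.
Proof. by move=> hb hc x /=; rewrite hb hc. Qed.

Lemma square_sym (P Q P' Q' : Type) (b : bij P Q) (b' : bij P' Q') p q :
  square b b' p q -> square (bsym b) (bsym b') q p.
Proof. by move=> h y /=; rewrite -{1}(bwdK b y) -h fwdK. Qed.

Definition precomp (C : category) (X X' Y : C) (i : iso X' X) :
  bij (hom X Y) (hom X' Y).
Proof.
exists (fun h => h ∘ i) (fun h => h ∘ iso_inv i) => h /=.
- by rewrite -comp_assoc iso_invK comp_idr.
- by rewrite -comp_assoc iso_homK comp_idr.
Defined.

Definition postcomp (C : category) (X Y Y' : C) (i : iso Y Y') :
  bij (hom X Y) (hom X Y').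
Proof.
exists (fun h => i ∘ h) (fun h => iso_inv i ∘ h) => h /=.
- by rewrite comp_assoc iso_homK comp_idl.
- by rewrite comp_assoc iso_invK comp_idl.
Defined.

Lemma precomp_square (C : category) (X X' Y X2 X2' Y2 : C) (i : iso X' X)
    (i2 : iso X2' X2) (f : hom X2 X) (f' : hom X2' X') (g : hom Y Y2) :
  f ∘ i2 = i ∘ f' ->
  square (precomp Y i) (precomp Y2 i2) (fun h => g ∘ (h ∘ f))
     (fun h => g ∘ (h ∘ f')).
Proof. by move=> E h /=; rewrite -!comp_assoc E. Qed.

Lemma postcomp_square (C : category) (X Y Y' X2 Y2 Y2' : C) (i : iso Y Y')
    (i2 : iso Y2 Y2') (f : hom X2 X) (g : hom Y Y2) (g' : hom Y' Y2') :
  i2 ∘ g = g' ∘ i ->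
  square (postcomp X i) (postcomp X2 i2) (fun h => g ∘ (h ∘ f))
     (fun h => g' ∘ (h ∘ f)).
Proof. by move=> E h /=; rewrite !comp_assoc E. Qed.

Lemma precomp_square1 (C : category) (X X' Y X2 X2' : C) (i : iso X' X)
    (i2 : iso X2' X2) (f : hom X2 X) (f' : hom X2' X') :
  f ∘ i2 = i ∘ f' ->
  square (precomp Y i) (precomp Y i2) (fun h => h ∘ f) (fun h => h ∘ f').
Proof. by move=> E h /=; rewrite -!comp_assoc E. Qed.

Lemma postcomp_square1 (C : category) (X Y Y' X2 : C) (i : iso Y Y')
    (f : hom X2 X) :
  square (postcomp X i) (postcomp X2 i) (fun h => h ∘ f) (fun h => h ∘ f).
Proof. by move=> h /=; rewrite comp_assoc. Qed.

Definition adjb (C D : category) (L : functor D C) (R : functor C D)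
    (a : adjunction L R) (V : D) (X : C) : bij (hom (L V) X) (hom V (R X)).
Proof.
exists (fun h => fmap R h ∘ adj_unit a V) (fun h => adj_counit a X ∘ fmap L h)
  => h.
- rewrite fmap_comp comp_assoc adj_counit_nat -comp_assoc.
  by rewrite adj_triangle_l comp_idr.
- rewrite fmap_comp -comp_assoc -adj_unit_nat comp_assoc.
  by rewrite adj_triangle_r comp_idl.
Defined.

Lemma adjb_square (C D : category) (L : functor D C) (R : functor C D)
    (a : adjunction L R) (V V' : D) (X X' : C) (f : hom V' V) (g : hom X X') :
  square (adjb a V X) (adjb a V' X') (fun h => g ∘ (h ∘ fmap L f))
     (fun h => fmap R g ∘ (h ∘ f)).
Proof.
by move=> h /=; rewrite !fmap_comp -!comp_assoc -adj_unit_nat.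
Qed.

Lemma adjb_square1 (C D : category) (L : functor D C) (R : functor C D)
    (a : adjunction L R) (V V' : D) (X : C) (f : hom V' V) :
  square (adjb a V X) (adjb a V' X) (fun h => h ∘ fmap L f) (fun h => h ∘ f).
Proof.
by move=> h; have := adjb_square a f (idm X) h; rewrite fmap_id !comp_idl.
Qed.

Section Yoneda.
Variables (C : category) (A B : C) (u : forall X, bij (hom X A) (hom X B)).
Hypothesis u_nat : forall X X' (f : hom X' X),
  square (u X) (u X') (fun h => h ∘ f) (fun h => h ∘ f).

Lemma yonedaE X (h : hom X A) : u X h = u A (idm A) ∘ h.
Proof. by rewrite -(u_nat h) comp_idl. Qed.

Definition yoneda_iso : iso A B.
Proof.
exists (u A (idm A)) (bwd (u B) (idm B)).
- by rewrite -(fwdK (u A) (_ ∘ _)) yonedaE comp_assoc -yonedaE bwdK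
     comp_idl fwdK.
- by rewrite -yonedaE bwdK.
Defined.
End Yoneda.

Lemma yoneda_nat (C D : category) (A B : functor D C)
    (u : forall V X, bij (hom X (A V)) (hom X (B V))) :
  (forall V V' X X' (g : hom V V') (f : hom X' X),
     square (u V X) (u V' X') (fun h => fmap A g ∘ (h ∘ f))
        (fun h => fmap B g ∘ (h ∘ f))) ->
  nat_isomorphic A B.
Proof.
move=> un.
have unX V X X' (f : hom X' X) :
    square (u V X) (u V X') (fun h => h ∘ f) (fun h => h ∘ f).
  move=> h; have := un V V X X' (idm V) f h.
  by rewrite !fmap_id !comp_idl.
exists (fun V => yoneda_iso (unX V)) => V V' g /=.
rewrite -yonedaE //; have := un V V' _ _ g (idm _) (idm _).
by rewrite !comp_idr.
Qed.

Lemma yoneda_isomorphic (C : category) (A B : C)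
    (u : forall X, bij (hom X A) (hom X B)) :
  (forall X X' (f : hom X' X),
     square (u X) (u X') (fun h => h ∘ f) (fun h => h ∘ f)) ->
  isomorphic A B.
Proof. by move=> un; constructor; apply: yoneda_iso un. Qed.

Lemma nat_iso_op (C D : category) (A B : functor D C) :
  nat_isomorphic (op_functor A) (op_functor B) -> nat_isomorphic A B.
Proof.
case=> eta eta_nat; exists (fun V => unop_iso (eta V)) => V W f /=.
apply/esym; have /= := @iso_square_inv _ _ _ _ _ (eta W) (eta V) _ _ (eta_nat W V f).
by move=> /= ->.
Qed.

Lemma coyoneda_nat (C D : category) (A B : functor D C)
    (u : forall V X, bij (hom (A V) X) (hom (B V) X)) :
  (forall V V' X X' (v : hom V' V) (x : hom X X'),
     square (u V X) (u V' X') (fun h => x ∘ (h ∘ fmap A v))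
        (fun h => x ∘ (h ∘ fmap B v))) ->
  nat_isomorphic A B.
Proof.
move=> un; apply: nat_iso_op.
apply: (@yoneda_nat (op C) (op D) (op_functor A) (op_functor B) u).
by move=> V V' X X' g f h /=; rewrite -!comp_assoc; apply: un.
Qed.

(** * Dualities *)

Section Dualities.
Variable C : rcat.
Implicit Types A B X Y : C.

(** [flat] and [sharp] are the two directions of the adjunction between
    tensoring on the right with B and with A. *)
Definition flat A B (d : dual A B) X Y (k : hom X (Y ⊗ A)) : hom (X ⊗ B) Y :=
  rho Y ∘ (idm Y ⊠ ev d) ∘ alpha Y A B ∘ (k ⊠ idm B).

Definition sharp A B (d : dual A B) X Y (h : hom (X ⊗ B) Y) : hom X (Y ⊗ A) :=
  (h ⊠ idm A) ∘ (iso_inv (alpha X B A) ∘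
     ((idm X ⊠ coev d) ∘ iso_inv (rho X))).

(** [g'] is the transpose of [g] under the two dualities.  The relation is used
    in place of a dual functor: naturality in an object that enters through
    its dual only requires that some transpose exists. *)
Definition mated A B A' B' (d : dual A B) (d' : dual A' B')
    (g : hom A A') (g' : hom B' B) : Prop :=
  ev d' ∘ (g ⊠ idm B') = ev d ∘ (idm A ⊠ g').

Lemma flat_nat A B A' B' (d : dual A B) (d' : dual A' B') X X' Y Y'
    (f : hom X' X) (y : hom Y Y') (g : hom A A') (g' : hom B' B)
    (k : hom X (Y ⊗ A)) :
  mated d d' g g' ->
  flat d' ((y ⊠ g) ∘ (k ∘ f)) = y ∘ (flat d k ∘ (f ⊠ g')).
Proof.
move=> E; rewrite /flat.
have -> : ((y ⊠ g) ∘ (k ∘ f)) ⊠ idm B'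
    = ((y ⊠ g) ⊠ idm B') ∘ ((k ∘ f) ⊠ idm B').
  by rewrite -tensm_comp comp_idl.
rewrite comp_assoc (comp_rewrite (associator_nat _ _ _ _)) comp_assoc.
have E2 : (idm Y' ⊠ ev d') ∘ (y ⊠ (g ⊠ idm B'))
    = (y ⊠ idm (one C)) ∘ (idm Y ⊠ ev d) ∘ (idm Y ⊠ (idm A ⊠ g')).
  by rewrite -!tensm_comp E !comp_idl !comp_idr.
rewrite (comp_rewrite E2) !comp_assoc runitor_nat.
rewrite (comp_rewrite (esym (associator_nat _ _ _ _))) tensm_id -!comp_assoc.
by rewrite -!tensm_comp !comp_idr !comp_idl.
Qed.

(** Pull [h] out by naturality; what remains is X tensored with the zigzag
    identity of B. *)
Lemma sharpK A B (d : dual A B) X Y (h : hom (X ⊗ B) Y) :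
  flat d (sharp d h) = h.
Proof.
have -> : sharp d h = (h ⊠ idm A) ∘ sharp d (idm (X ⊗ B)).
  by rewrite /sharp tensm_id comp_idl.
have := @flat_nat _ _ _ _ d d X X _ Y (idm X) h (idm A) (idm B)
  (sharp d (idm (X ⊗ B))) erefl.
rewrite comp_idr tensm_id comp_idr => ->.
rewrite -[RHS]comp_idr; congr (_ ∘ _).
rewrite /flat /sharp tensm_id comp_idl runitor_tens -tensm_id.
rewrite (comp_rewrite (associator_nat _ _ _ _)) !comp_assoc.
rewrite (comp_rewrite (pentagon _ _ _ _ _)) !comp_assoc.
rewrite (comp_rewrite (esym (tensm_comp _ _ _ _ _))) !comp_assoc iso_invK !comp_idl.
rewrite -[in X in _ ∘ X](comp_idl (idm B)) tensm_comp comp_assoc.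
rewrite (comp_rewrite (associator_nat _ _ _ _)) comp_assoc.
rewrite (comp_rewrite (triangle_inv _ _)) -!tensm_comp !comp_idl.
by rewrite duality_zigzag_right.
Qed.
End Dualities.

(** In the opposite category [sharp] is [flat] for the opposite duality. *)
Lemma flatK (C : rcat) (A B : C) (d : dual A B) (X Y : C)
    (k : hom X (Y ⊗ A)) : sharp d (flat d k) = k.
Proof.
have := @sharpK (op_rcat C) B A (op_duality d) Y X k.
by rewrite /flat /sharp /= !comp_assoc.
Qed.

Section Pairings.
Variable C : rcat.
Implicit Types A B X Y : C.

Definition flatb A B (d : dual A B) X Y :
  bij (hom X (Y ⊗ A)) (hom (X ⊗ B) Y) :=
  Bij (@flatK C A B d X Y) (@sharpK C A B d X Y).

Lemma flatb_square A B A' B' (d : dual A B) (d' : dual A' B') X X' Y Y'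
    (f : hom X' X) (y : hom Y Y') (g : hom A A') (g' : hom B' B) :
  mated d d' g g' ->
  square (flatb d X Y) (flatb d' X' Y') (fun k => (y ⊠ g) ∘ (k ∘ f))
     (fun h => y ∘ (h ∘ (f ⊠ g'))).
Proof. by move=> E k; apply: flat_nat. Qed.

Lemma flat_lunitor A B (d : dual A B) X (k : hom X A) :
  flat d (iso_inv (lam A) ∘ k) = ev d ∘ (k ⊠ idm B).
Proof.
rewrite /flat -unitor_one lunitor_nat.
rewrite (comp_rewrite (lunitor_tens _ _)) -[LHS]comp_assoc -tensm_comp.
by rewrite comp_assoc iso_invK !comp_idl.
Qed.

(** The case Y = 1 of [flatb], with the unit tensor factor removed: morphisms
    into a dual are the same as pairings. *)
Definition pairb A B (d : dual A B) X : bij (hom X A) (hom (X ⊗ B) (one C)) :=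
  postcomp X (iso_sym (lam A)) ;; flatb d X (one C).

Lemma pairbE A B (d : dual A B) X (k : hom X A) :
  pairb d X k = ev d ∘ (k ⊠ idm B).
Proof. exact: flat_lunitor. Qed.

Lemma pairb_square A B A' B' (d : dual A B) (d' : dual A' B') X X'
    (f : hom X' X) (g : hom A A') (g' : hom B' B) :
  mated d d' g g' ->
  square (pairb d X) (pairb d' X') (fun k => g ∘ (k ∘ f))
     (fun h => h ∘ (f ⊠ g')).
Proof.
move=> E k; rewrite !pairbE.
have -> : (g ∘ (k ∘ f)) ⊠ idm B' = (g ⊠ idm B') ∘ ((k ∘ f) ⊠ idm B').
  by rewrite -tensm_comp comp_idl.
rewrite comp_assoc E -!comp_assoc -!tensm_comp.
by rewrite !comp_idr !comp_idl.
Qed.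

End Pairings.

Lemma mated_rev (C : rcat) (A B A' B' : C) (d : dual A B) (d' : dual A' B')
    (g : hom A A') (g' : hom B' B) :
  mated d d' g g' ->
  @mated (rev_rcat C) _ _ _ _ (rev_duality d') (rev_duality d) g' g.
Proof. by move=> E; rewrite /mated /= E. Qed.

Section LeftPairings.
Variable C : rcat.
Implicit Types A B X Y : C.

Definition lflatb A B (d : dual A B) X Y :
    bij (hom X (B ⊗ Y)) (hom (A ⊗ X) Y) :=
  @flatb (rev_rcat C) _ _ (rev_duality d) X Y.

Lemma lflatb_square A B A' B' (d : dual A B) (d' : dual A' B') X X' Y Y'
    (f : hom X' X) (y : hom Y Y') (g : hom A' A) (g' : hom B B') :
  mated d' d g g' ->
  square (lflatb d X Y) (lflatb d' X' Y') (fun k => (g' ⊠ y) ∘ (k ∘ f))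
     (fun h => y ∘ (h ∘ (g ⊠ f))).
Proof. by move=> E; apply: (@flatb_square (rev_rcat C)); apply: mated_rev. Qed.

Definition lpairb A B (d : dual A B) X : bij (hom X B) (hom (A ⊗ X) (one C)) :=
  @pairb (rev_rcat C) _ _ (rev_duality d) X.

Lemma lpairbE A B (d : dual A B) X (k : hom X B) :
  lpairb d X k = ev d ∘ (idm A ⊠ k).
Proof. exact: (@pairbE (rev_rcat C)). Qed.

Lemma lpairb_square A B A' B' (d : dual A B) (d' : dual A' B') X X'
    (f : hom X' X) (g : hom A' A) (g' : hom B B') :
  mated d' d g g' ->
  square (lpairb d X) (lpairb d' X') (fun k => g' ∘ (k ∘ f))
     (fun h => h ∘ (g ⊠ f)).
Proof. by move=> E; apply: (@pairb_square (rev_rcat C)); apply: mated_rev. Qed.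

Lemma mate_right A B A' B' (d : dual A B) (d' : dual A' B') (g : hom A A') :
  exists g' : hom B' B, mated d d' g g'.
Proof.
exists (bwd (lpairb d B') (ev d' ∘ (g ⊠ idm B'))).
by rewrite /mated -lpairbE bwdK.
Qed.

Lemma mate_left A B A' B' (d : dual A B) (d' : dual A' B') (g' : hom B' B) :
  exists g : hom A A', mated d d' g g'.
Proof.
exists (bwd (pairb d' A) (ev d ∘ (idm A ⊠ g'))).
by rewrite /mated -pairbE bwdK.
Qed.

Lemma mated_id A B (d : dual A B) : mated d d (idm A) (idm B).
Proof. by []. Qed.

End LeftPairings.

Lemma flatb_square1 (C : rcat) (A B A' B' : C) (d : dual A B) (d' : dual A' B')
    (X X' Y : C) (f : hom X' X) (g : hom A A') (g' : hom B' B) :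
  mated d d' g g' ->
  square (flatb d X Y) (flatb d' X' Y) (fun k => (idm Y ⊠ g) ∘ (k ∘ f))
     (fun h => h ∘ (f ⊠ g')).
Proof.
by move=> E h; have /= -> := flatb_square f (idm Y) E h; rewrite comp_idl.
Qed.

Lemma pairb_square1 (C : rcat) (A B : C) (d : dual A B) (X X' : C)
    (f : hom X' X) :
  square (pairb d X) (pairb d X') (fun k => k ∘ f) (fun h => h ∘ (f ⊠ idm B)).
Proof. by move=> k; rewrite -(pairb_square f (mated_id d)) comp_idl. Qed.

Lemma lpairb_square1 (C : rcat) (A B : C) (d : dual A B) (X X' : C)
    (f : hom X' X) :
  square (lpairb d X) (lpairb d X') (fun k => k ∘ f) (fun h => h ∘ (idm A ⊠ f)).
Proof. exact: (@pairb_square1 (rev_rcat C)). Qed.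

Lemma right_dual_isomorphic (C : rcat) (A B A' B' : C) (d : dual A B)
    (d' : dual A' B') : isomorphic A A' -> isomorphic B B'.
Proof.
case=> i.
apply: (yoneda_isomorphic (u := fun X => lpairb d X ;;
  precomp (one C) (iso_tens _ (iso_sym i) (iso_id X)) ;; bsym (lpairb d' X))).
move=> X X' f; apply: square_comp (square_sym (lpairb_square1 _ _)).
apply: square_comp (lpairb_square1 _ _) _; apply: precomp_square1.
by rewrite /= -!tensm_comp !comp_idl !comp_idr.
Qed.

Lemma left_dual_isomorphic (C : rcat) (A B A' B' : C) (d : dual A B)
    (d' : dual A' B') : isomorphic B B' -> isomorphic A A'.
Proof.
exact: (@right_dual_isomorphic (rev_rcat C) _ _ _ _ (rev_duality d)
  (rev_duality d')).
Qed.

(** * Strong monoidal functors *)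

Definition rtens (C : rcat) (A : C) : functor C C.
Proof.
refine (@Functor C C (fun V => V ⊗ A) (fun _ _ f => f ⊠ idm A) _ _).
- by move=> X; apply: tensm_id.
- by move=> X Y Z g f; rewrite -tensm_comp comp_idl.
Defined.

Definition ltens (C : rcat) (A : C) : functor C C.
Proof.
refine (@Functor C C (fun V => A ⊗ V) (fun _ _ f => idm A ⊠ f) _ _).
- by move=> X; apply: tensm_id.
- by move=> X Y Z g f; rewrite -tensm_comp comp_idl.
Defined.

Lemma nat_rtens (C : category) (D : rcat) (H : functor D C) (A B : D) :
  isomorphic A B -> nat_isomorphic (fcomp H (rtens A)) (fcomp H (rtens B)).
Proof.
case=> i; exists (fun V => iso_fmap H (iso_tens _ (iso_id V) i)) => V W f /=.
by rewrite -!fmap_comp -!tensm_comp !comp_idl !comp_idr.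
Qed.

Lemma nat_ltens (C : category) (D : rcat) (H : functor D C) (A B : D) :
  isomorphic A B -> nat_isomorphic (fcomp H (ltens A)) (fcomp H (ltens B)).
Proof. exact: (@nat_rtens C (rev_rcat D)). Qed.

Record strong_monoidal (C D : rcat) (F : functor C D) := StrongMonoidal {
  sm_mul : forall X Y : C, iso (F X ⊗ F Y) (F (X ⊗ Y));
  sm_unit : iso (one D) (F (one C));
  sm_mul_nat : forall (X X' Y Y' : C) (f : hom X X') (g : hom Y Y'),
    sm_mul X' Y' ∘ (fmap F f ⊠ fmap F g) = fmap F (f ⊠ g) ∘ sm_mul X Y;
  sm_assoc : forall X Y Z : C,
    fmap F (alpha X Y Z) ∘ sm_mul (X ⊗ Y) Z ∘ (sm_mul X Y ⊠ idm (F Z))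
    = sm_mul X (Y ⊗ Z) ∘ (idm (F X) ⊠ sm_mul Y Z) ∘ alpha (F X) (F Y) (F Z);
  sm_unitl : forall X : C,
    fmap F (lam X) ∘ sm_mul (one C) X ∘ (sm_unit ⊠ idm (F X)) = lam (F X);
  sm_unitr : forall X : C,
    fmap F (rho X) ∘ sm_mul X (one C) ∘ (idm (F X) ⊠ sm_unit) = rho (F X)
}.

Section StrongMonoidal.
Variables (C D : rcat) (F : functor C D) (S : strong_monoidal F).

Definition op_strong_monoidal :
  @strong_monoidal (op_rcat C) (op_rcat D) (op_functor F).
Proof.
refine (@StrongMonoidal (op_rcat C) (op_rcat D) (op_functor F)
  (fun X Y => op_iso (sm_mul S X Y)) (op_iso (sm_unit S)) _ _ _ _) => /=.
- by move=> X X' Y Y' f g; apply/esym/iso_square_inv/sm_mul_nat.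
- move=> X Y Z.
  exact: (@iso_inv_eq _ _ _
    (iso_comp (iso_comp (iso_fmap F (alpha X Y Z)) (sm_mul S (X ⊗ Y) Z))
      (iso_tens _ (sm_mul S X Y) (iso_id (F Z))))
    (iso_comp (iso_comp (sm_mul S X (Y ⊗ Z))
      (iso_tens _ (iso_id (F X)) (sm_mul S Y Z))) (alpha _ _ _))
    (sm_assoc S _ _ _)).
- move=> X; exact: (@iso_inv_eq _ _ _
    (iso_comp (iso_comp (iso_fmap F (lam X)) (sm_mul S _ X))
      (iso_tens _ (sm_unit S) (iso_id (F X)))) (lam (F X)) (sm_unitl S _)).
- move=> X; exact: (@iso_inv_eq _ _ _
    (iso_comp (iso_comp (iso_fmap F (rho X)) (sm_mul S X _))
      (iso_tens _ (iso_id (F X)) (sm_unit S))) (rho (F X)) (sm_unitr S _)).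
Defined.

Definition rev_strong_monoidal :
  @strong_monoidal (rev_rcat C) (rev_rcat D) F.
Proof.
refine (@StrongMonoidal (rev_rcat C) (rev_rcat D) F
  (fun X Y => sm_mul S Y X) (sm_unit S) _ _ _ _) => /=.
- by move=> X X' Y Y' f g; apply: sm_mul_nat.
- move=> X Y Z; apply: (@iso_cancelr _ _ _ _ (alpha (F Z) (F Y) (F X))).
  rewrite (comp_rewrite (iso_homK _)) comp_idr.
  apply: (@iso_cancell _ _ _ _ (iso_fmap F (alpha Z Y X))) => /=.
  by rewrite !comp_assoc -fmap_comp iso_invK fmap_id comp_idl -sm_assoc.
- exact: sm_unitr.
- exact: sm_unitl.
Defined.

Section Duality.
Variables (A B : C) (d : dual A B).

Definition sm_ev : hom (F A ⊗ F B) (one D) :=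
  iso_inv (sm_unit S) ∘ fmap F (ev d) ∘ sm_mul S A B.

Definition sm_coev : hom (one D) (F B ⊗ F A) :=
  iso_inv (sm_mul S B A) ∘ (fmap F (coev d) ∘ sm_unit S).

(** Conjugating by the structure isomorphisms of F turns the zigzag composite
    into the image under F of the zigzag composite of [d]. *)
Lemma sm_zigzag :
  rho (F B) ∘ (idm (F B) ⊠ sm_ev) ∘ alpha (F B) (F A) (F B) ∘
    (sm_coev ⊠ idm (F B)) ∘ iso_inv (lam (F B)) = idm (F B).
Proof.
have E1 : rho (F B) ∘ (idm (F B) ⊠ sm_ev)
   = fmap F (rho B) ∘ fmap F (idm B ⊠ ev d) ∘ sm_mul S B (A ⊗ B)
     ∘ (idm (F B) ⊠ sm_mul S A B).
  rewrite -(sm_unitr S) -comp_assoc -tensm_comp !comp_assoc iso_invK !comp_idl.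
  rewrite (comp_rewrite (esym (sm_mul_nat _ _ _))) !comp_assoc fmap_id.
  by rewrite -[RHS]comp_assoc -tensm_comp comp_idl.
have E2 : (sm_coev ⊠ idm (F B)) ∘ iso_inv (lam (F B))
   = (iso_inv (sm_mul S B A) ⊠ idm (F B)) ∘ (iso_inv (sm_mul S (B ⊗ A) B)
     ∘ (fmap F (coev d ⊠ idm B) ∘ fmap F (iso_inv (lam B)))).
  apply: (@iso_cancelr _ _ _ _ (lam (F B))).
  rewrite -comp_assoc iso_homK comp_idr -(sm_unitl S).
  rewrite !comp_assoc (comp_rewrite (esym (fmap_comp _ _ _))) iso_homK fmap_id.
  rewrite comp_idr (comp_rewrite (esym (sm_mul_nat _ _ _))) fmap_id !comp_assoc.
  rewrite (comp_rewrite (iso_homK _)) comp_idr -!tensm_comp !comp_idl.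
  by rewrite -[in RHS]comp_assoc.
rewrite E1 -[LHS]comp_assoc E2.
have E3 : fmap F (alpha B A B)
   = sm_mul S B (A ⊗ B) ∘ (idm (F B) ⊠ sm_mul S A B) ∘ alpha (F B) (F A) (F B)
     ∘ (iso_inv (sm_mul S B A) ⊠ idm (F B)) ∘ iso_inv (sm_mul S (B ⊗ A) B).
  rewrite -sm_assoc -[_ ∘ (_ ⊠ _) ∘ (_ ⊠ _)]comp_assoc -tensm_comp.
  rewrite iso_invK comp_idl tensm_id comp_idr.
  by rewrite -comp_assoc iso_invK comp_idr.
transitivity (fmap F (idm B)); last exact: fmap_id.
by rewrite -{3}(duality_zigzag_right d) !fmap_comp E3 !comp_assoc.
Qed.
End Duality.
End StrongMonoidal.

Definition sm_duality (C D : rcat) (F : functor C D) (S : strong_monoidal F)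
    (A B : C) (d : dual A B) : dual (F A) (F B).
Proof.
exists (sm_ev S d) (sm_coev S d); first exact: sm_zigzag.
have := @sm_zigzag _ _ _ (op_strong_monoidal S) _ _ (op_duality d).
by rewrite /sm_ev /sm_coev /= !comp_assoc.
Defined.

Lemma sm_mated (C D : rcat) (F : functor C D) (S : strong_monoidal F)
    (A B A' B' : C) (d : dual A B) (d' : dual A' B') (g : hom A A')
    (g' : hom B' B) :
  mated d d' g g' ->
  mated (sm_duality S d) (sm_duality S d') (fmap F g) (fmap F g').
Proof.
rewrite /mated /= /sm_ev => E; rewrite -!comp_assoc -!fmap_id !sm_mul_nat.
by congr (_ ∘ _); rewrite !comp_assoc -!fmap_comp E.
Qed.

(** * Adjoint strings and the projection formula *)

(** The data L ⊣ F ⊣ R around a strong monoidal functor.  Bundling them makes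
    the two symmetries [op_string] and [rev_string] operations on a single
    argument. *)
Record adjoint_string := AdjointString {
  st_C : rcat;
  st_D : rcat;
  st_F : functor st_C st_D;
  st_S : strong_monoidal st_F;
  st_L : functor st_D st_C;
  st_R : functor st_D st_C;
  st_LF : adjunction st_L st_F;
  st_FR : adjunction st_F st_R
}.

Definition op_string (T : adjoint_string) : adjoint_string :=
  AdjointString (op_strong_monoidal (st_S T)) (op_adjunction (st_FR T))
    (op_adjunction (st_LF T)).

Definition rev_string (T : adjoint_string) : adjoint_string :=
  @AdjointString (rev_rcat (st_C T)) (rev_rcat (st_D T)) (st_F T)
    (rev_strong_monoidal (st_S T)) (st_L T) (st_R T) (st_LF T) (st_FR T).

Section Strings.
Variable T : adjoint_string.
Local Notation C := (st_C T).
Local Notation D := (st_D T).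
Local Notation F := (st_F T).
Local Notation S := (st_S T).
Local Notation L := (st_L T).
Local Notation R := (st_R T).
Local Notation LF := (st_LF T).
Local Notation FR := (st_FR T).
Local Notation dr X := (right_duality (rc_rigid _) X).
Local Notation dl X := (left_duality (rc_rigid _) X).

(** Hom(X, R(V) ⊗ Y) ≅ Hom(X ⊗ Y', R(V)) ≅ Hom(F(X ⊗ Y'), V)
    ≅ Hom(F X ⊗ F Y', V) ≅ Hom(F X, V ⊗ F Y) ≅ Hom(X, R(V ⊗ F Y)), where
    F Y' is a right dual of F Y because F is strong monoidal. *)
Definition projb (V : D) (Y X : C) :
    bij (hom X (R V ⊗ Y)) (hom X (R (V ⊗ F Y))) :=
  flatb (dr Y) X (R V) ;; bsym (adjb FR _ V) ;; precomp V (sm_mul S X _) ;;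
  bsym (flatb (sm_duality S (dr Y)) (F X) V) ;; adjb FR X _.

Lemma projb_square (V V' : D) (Y Y' X X' : C) (v : hom V V') (y : hom Y Y')
    (f : hom X' X) :
  square (projb V Y X) (projb V' Y' X') (fun h => (fmap R v ⊠ y) ∘ (h ∘ f))
     (fun h => fmap R (v ⊠ fmap F y) ∘ (h ∘ f)).
Proof.
have [y' my] := mate_right (dr Y) (dr Y') y.
apply: square_comp (adjb_square FR _ _).
apply: square_comp (square_sym (flatb_square _ _ (sm_mated S my))).
apply: square_comp (precomp_square _ (esym (sm_mul_nat S f y'))).
by apply: square_comp (square_sym (adjb_square FR _ _)); apply: flatb_square.
Qed.

Lemma projb_square1 (V : D) (Y X X' : C) (f : hom X' X) :
  square (projb V Y X) (projb V Y X') (fun h => h ∘ f) (fun h => h ∘ f).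
Proof.
move=> h; have := projb_square (idm V) (idm Y) f h.
by rewrite !fmap_id !tensm_id fmap_id !comp_idl.
Qed.

Definition proj_iso (V : D) (Y : C) : iso (R V ⊗ Y) (R (V ⊗ F Y)) :=
  yoneda_iso (@projb_square1 V Y).

Lemma proj_iso_nat (V V' : D) (Y Y' : C) (v : hom V V') (y : hom Y Y') :
  proj_iso V' Y' ∘ (fmap R v ⊠ y) = fmap R (v ⊠ fmap F y) ∘ proj_iso V Y.
Proof.
apply: etrans (esym (yonedaE (@projb_square1 V' Y') _)) _.
by have := projb_square v y (idm _) (idm _); rewrite !comp_idr.
Qed.

Lemma proj_iso_inv_nat (V V' : D) (Y Y' : C) (v : hom V V') (y : hom Y Y') :
  (fmap R v ⊠ y) ∘ iso_sym (proj_iso V Y)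
  = iso_sym (proj_iso V' Y') ∘ fmap R (v ⊠ fmap F y).
Proof. exact/esym/iso_square_inv/proj_iso_nat. Qed.

(** The functor R is recovered from V |-> Hom(R(V), 1) alone, since the
    projection formula absorbs an arbitrary target X into the argument of R as
    F X'. *)
Lemma right_from_left (A G : D) (d : dual A G)
    (w : forall V, bij (hom (R V) (one C)) (hom V G)) :
  (forall V V' (v : hom V' V),
     square (w V) (w V') (fun h => h ∘ fmap R v) (fun h => h ∘ v)) ->
  nat_isomorphic R (fcomp L (ltens A)).
Proof.
move=> w_nat.
pose u (V : D) (X : C) : bij (hom (R V) X) (hom (L (A ⊗ V)) X) :=
  pairb (dr X) (R V) ;; precomp _ (iso_sym (proj_iso V _)) ;; w _ ;;
  bsym (flatb (sm_duality S (dr X)) V G) ;; lflatb d V (F X) ;;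
  bsym (adjb LF _ X).
apply: (@coyoneda_nat _ _ R (fcomp L (ltens A)) u) => V V' X X' v x.
have [x' mx] := mate_right (dr X) (dr X') x.
apply: square_comp (square_sym (adjb_square LF _ _)).
apply: square_comp (lflatb_square _ _ (mated_id d)).
apply: square_comp (square_sym (flatb_square1 _ (sm_mated S mx))).
apply: square_comp (w_nat _ _ _).
apply: square_comp (precomp_square1 (proj_iso_inv_nat _ _)).
exact: pairb_square.
Qed.

(** * Exchanging the two adjoints by duality *)

Local Notation ld X := (left_dual (rc_rigid _) X).
Local Notation rd X := (right_dual (rc_rigid _) X).

(** Hom(L(V), Y) ≅ Hom(V, F Y) ≅ Hom(V ⊗ F Y', 1) ≅ Hom(F Y', V')
    ≅ Hom(Y', R(V')) ≅ Hom(`(R(V')) ⊗ Y', 1) ≅ Hom(`(R(V')), Y). *)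
Definition left_as_dualb (V : D) (Y : C) :
    bij (hom (L V) Y) (hom (ld (R (rd V))) Y) :=
  adjb LF V Y ;; pairb (sm_duality S (dr Y)) V ;; bsym (lpairb (dr V) _) ;;
  adjb FR _ _ ;; lpairb (dl (R (rd V))) _ ;; bsym (pairb (dr Y) _).

Lemma left_as_dualb_square (V V' : D) (Y Y' : C) (v : hom V' V) (y : hom Y Y')
    (v' : hom (rd V) (rd V')) (z : hom (ld (R (rd V'))) (ld (R (rd V)))) :
  mated (dr V') (dr V) v v' -> mated (dl _) (dl _) z (fmap R v') ->
  square (left_as_dualb V Y) (left_as_dualb V' Y')
    (fun h => y ∘ (h ∘ fmap L v)) (fun h => y ∘ (h ∘ z)).
Proof.
move=> mv mz; have [y' my] := mate_right (dr Y) (dr Y') y.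
apply: square_comp (square_sym (pairb_square _ my)).
apply: square_comp (lpairb_square _ mz).
apply: square_comp (adjb_square FR _ _).
apply: square_comp (square_sym (lpairb_square _ mv)).
apply: square_comp (pairb_square _ (sm_mated S my)).
exact: adjb_square.
Qed.

Lemma left_as_dualb_square1 (V : D) (Y Y' : C) (y : hom Y Y') :
  square (left_as_dualb V Y) (left_as_dualb V Y') (fun h => y ∘ h)
    (fun h => y ∘ h).
Proof.
move=> h; have := left_as_dualb_square y (mated_id (dr V)).
move=> /(_ (idm _)); rewrite fmap_id => /(_ (mated_id _) h).
by rewrite fmap_id !comp_idr.
Qed.

Definition left_as_dual (V : D) : iso (L V) (ld (R (rd V))) :=
  unop_iso (@yoneda_iso (op C) (L V) (ld (R (rd V))) (left_as_dualb V)
    (@left_as_dualb_square1 V)).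

Lemma left_as_dual_nat (V V' : D) (v : hom V' V) (v' : hom (rd V) (rd V'))
    (z : hom (ld (R (rd V'))) (ld (R (rd V)))) :
  mated (dr V') (dr V) v v' -> mated (dl _) (dl _) z (fmap R v') ->
  left_as_dual V ∘ fmap L v = z ∘ left_as_dual V'.
Proof.
move=> mv mz; apply: (@iso_square_inv _ _ _ _ _ (iso_sym (left_as_dual V'))
  (iso_sym (left_as_dual V))) => /=.
have /= := @yonedaE (op C) (L V') (ld (R (rd V'))) (left_as_dualb V')
    (@left_as_dualb_square1 V') _ (fmap L v) => <-.
have := left_as_dualb_square (idm _) mv mz (idm _).
by rewrite !comp_idl.
Qed.

Section Transfer.
Variables (A chi : D) (d : dual A chi).
Variable r : forall V, iso (R V) (L (V ⊗ chi)).
Hypothesis r_nat : forall V V' (v : hom V V'),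
  r V' ∘ fmap R v = fmap L (v ⊠ idm chi) ∘ r V.

Lemma r_inv_nat V V' (v : hom V V') :
  iso_sym (r V') ∘ fmap L (v ⊠ idm chi) = fmap R v ∘ iso_sym (r V).
Proof. exact/iso_square_inv. Qed.

(** Hom(X, L(V)) ≅ Hom(X, `(R(V'))) ≅ Hom(R(V'), X') ≅ Hom(L(V' ⊗ χ), X')
    ≅ Hom(V' ⊗ χ, F X') ≅ Hom(F X ⊗ V' ⊗ χ, 1) ≅ Hom(F X ⊗ V', A)
    ≅ Hom(F X, A ⊗ V) ≅ Hom(X, R(A ⊗ V)). *)
Definition transferb (V : D) (X : C) :
    bij (hom X (L V)) (hom X (R (A ⊗ V))) :=
  postcomp X (left_as_dual V) ;; pairb (dl (R (rd V))) X ;;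
  bsym (lpairb (dr X) _) ;; precomp _ (iso_sym (r (rd V))) ;;
  adjb LF _ _ ;; lpairb (sm_duality S (dr X)) _ ;;
  precomp _ (alpha (F X) (rd V) chi) ;; bsym (pairb d _) ;;
  bsym (flatb (dr V) (F X) A) ;; adjb FR X _.

Lemma transferb_square (V W : D) (X X' : C) (v : hom V W) (f : hom X' X) :
  square (transferb V X) (transferb W X') (fun h => fmap L v ∘ (h ∘ f))
    (fun h => fmap R (idm A ⊠ v) ∘ (h ∘ f)).
Proof.
have [v' mv] := mate_right (dr V) (dr W) v.
have [f' mf] := mate_right (dr X') (dr X) f.
have [z mz] := mate_left (dl (R (rd V))) (dl (R (rd W))) (fmap R v').
apply: square_comp (adjb_square FR _ _).
apply: square_comp (square_sym (flatb_square _ _ mv)).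
apply: square_comp (square_sym (pairb_square _ (mated_id d))).
apply: square_comp (precomp_square1 (esym (associator_nat _ _ _ _))).
apply: square_comp (lpairb_square _ (sm_mated S mf)).
apply: square_comp (adjb_square LF _ _).
apply: square_comp (precomp_square _ (esym (r_inv_nat _))).
apply: square_comp (square_sym (lpairb_square _ mf)).
apply: square_comp (pairb_square _ mz).
exact: postcomp_square (left_as_dual_nat mv mz).
Qed.
End Transfer.

Lemma left_from_right (A chi : D) (d : dual A chi) :
  nat_isomorphic R (fcomp L (rtens chi)) ->
  nat_isomorphic L (fcomp R (ltens A)).
Proof.
case=> r r_nat.
exact: (@yoneda_nat _ _ L (fcomp R (ltens A)) _ (transferb_square d r_nat)).
Qed.

(** F(1) ≅ 1 gives Hom(L(V ⊗ A), 1) ≅ Hom(V ⊗ A, 1) ≅ Hom(V, `A), hence the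
    functor determines `A, and A is a right dual of `A. *)
Lemma left_rtens_inj (A B : D) :
  nat_isomorphic (fcomp L (rtens A)) (fcomp L (rtens B)) -> isomorphic A B.
Proof.
case=> e e_nat.
suff: isomorphic (ld A) (ld B) by apply: right_dual_isomorphic (dl _) (dl _).
pose b (E V : D) : bij (hom V (ld E)) (hom (L (V ⊗ E)) (one C)) :=
  pairb (dl E) V ;; postcomp _ (sm_unit S) ;; bsym (adjb LF _ _).
have b_square E V V' (v : hom V' V) :
    square (b E V) (b E V') (fun h => h ∘ v) (fun h => h ∘ fmap L (v ⊠ idm E)).
  apply: square_comp (square_sym (adjb_square1 _ _)).
  by apply: square_comp (postcomp_square1 _ _); apply: pairb_square1.
apply: (yoneda_isomorphic (u := fun V => b A V ;;
  precomp (one C) (iso_sym (e V)) ;; bsym (b B V))) => V V' v.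
apply: square_comp (square_sym (b_square _ _ _ _)).
apply: square_comp (b_square _ _ _ _) _; apply: precomp_square1.
exact/esym/(iso_square_inv (e_nat _ _ v)).
Qed.
End Strings.

(** * The relative modular object *)

Section Modular.
Variable T : adjoint_string.
Local Notation C := (st_C T).
Local Notation D := (st_D T).
Local Notation F := (st_F T).
Local Notation S := (st_S T).
Local Notation L := (st_L T).
Local Notation R := (st_R T).
Local Notation LF := (st_LF T).
Local Notation FR := (st_FR T).
Local Notation dr X := (right_duality (rc_rigid _) X).
Local Notation dl X := (left_duality (rc_rigid _) X).
Local Notation ld X := (left_dual (rc_rigid _) X).
Local Notation rd X := (right_dual (rc_rigid _) X).

(** G plays the role of the left dual of the relative modular object, which is
    then both G' and `G. *)
Definition dual_modular (G : D) : Prop :=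
  [/\ nat_isomorphic R (fcomp L (ltens (ld G))),
      nat_isomorphic R (fcomp L (rtens (rd G))),
      nat_isomorphic L (fcomp R (ltens G)) &
      nat_isomorphic L (fcomp R (rtens G))].

Lemma dual_modular_of_representation (G : D)
    (w : forall V, bij (hom (R V) (one C)) (hom V G)) :
  (forall V V' (v : hom V' V),
     square (w V) (w V') (fun h => h ∘ fmap R v) (fun h => h ∘ v)) ->
  dual_modular G.
Proof.
move=> w_nat.
have Rl := right_from_left (dl G) w_nat.
have Rr : nat_isomorphic R (fcomp L (rtens (rd G))) :=
  @right_from_left (rev_string T) _ _ (rev_duality (dr G)) w w_nat.
split=> //; first exact: left_from_right (dr G) Rr.
exact: (@left_from_right (rev_string T) _ _ (rev_duality (dl G)) Rl).
Qed.

Lemma dual_modular_of_right_adjoint (K : functor C D) :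
  adjunction R K -> exists G, dual_modular G.
Proof.
move=> a; exists (K (one C)).
apply: (@dual_modular_of_representation _ (fun V => adjb a V (one C))) => V V' v.
exact: adjb_square1.
Qed.

(** Hom(R(V), 1) ≅ Hom(L(V ⊗ χ), 1) ≅ Hom(V ⊗ χ, F(1)) ≅ Hom(V, F(1) ⊗ `χ). *)
Lemma dual_modular_of_modular (chi : D) :
  nat_isomorphic R (fcomp L (rtens chi)) -> exists G, dual_modular G.
Proof.
case=> r r_nat; exists (F (one C) ⊗ ld chi).
apply: (@dual_modular_of_representation _ (fun V =>
  precomp (one C) (iso_sym (r V)) ;; adjb LF _ _ ;;
  bsym (flatb (dl chi) V (F (one C))))) => V V' v.
have E := flatb_square1 (Y := F (one C)) v (mated_id (dl chi)).
have {}E : square (flatb (dl chi) V (F (one C))) (flatb (dl chi) V' (F (one C)))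
    (fun h => h ∘ v) (fun h => h ∘ (v ⊠ idm chi)).
  by move=> h; rewrite -E tensm_id comp_idl.
apply: square_comp (square_sym E); apply: square_comp (adjb_square1 _ _).
exact/precomp_square1/esym/(iso_square_inv (r_nat _ _ v)).
Qed.

(** L ≅ R(- ⊗ A) ≅ L(- ⊗ (A ⊗ B)), to be compared with L ≅ L(- ⊗ 1). *)
Lemma tens_cancel (A B : D) :
  nat_isomorphic L (fcomp R (rtens A)) ->
  nat_isomorphic R (fcomp L (rtens B)) -> isomorphic (A ⊗ B) (one D).
Proof.
move=> LR RL; apply: left_rtens_inj; apply: nat_sym.
have unit : nat_isomorphic (fcomp L (rtens (one D))) L.
  exists (fun V => iso_fmap L (rho V)) => V W f /=.
  by rewrite -!fmap_comp runitor_nat.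
have assoc : nat_isomorphic (fcomp (fcomp L (rtens B)) (rtens A))
    (fcomp L (rtens (A ⊗ B))).
  exists (fun V => iso_fmap L (alpha V A B)) => V W f /=.
  by rewrite -!fmap_comp associator_nat tensm_id.
apply: nat_trans unit (nat_trans LR (nat_trans _ assoc)).
exact: nat_whisker RL.
Qed.
End Modular.

(** G is invertible: G' ≅ (`G ⊗ G) ⊗ G' ≅ `G ⊗ (G ⊗ G') ≅ `G. *)
Lemma dual_modular_duals_isomorphic (T : adjoint_string) (G : st_D T) :
  dual_modular G -> isomorphic (right_dual (rc_rigid _) G)
                            (left_dual (rc_rigid _) G).
Proof.
case=> Rl Rr Ll Lr; have [i] := tens_cancel Lr Rr.
have [j] : isomorphic (left_dual (rc_rigid _) G ⊗ G) (one _) :=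
  @tens_cancel (rev_string T) _ _ Ll Rl.
constructor; set A := left_dual _ G; set B := right_dual _ G.
apply: iso_comp (rho A) _.
apply: iso_comp (iso_tens _ (iso_id A) i) _.
apply: iso_comp (alpha A G B) _.
exact: iso_comp (iso_tens _ (iso_sym j) (iso_id B)) (iso_sym (lam B)).
Qed.

Lemma dual_modular_exists (T : adjoint_string) :
  has_left_adjoint (st_L T) \/ has_right_adjoint (st_R T) \/
    (exists chi, nat_isomorphic (st_R T) (fcomp (st_L T) (rtens chi))) ->
  exists G : st_D T, dual_modular G.
Proof.
case=> [[K [a]]|[[K [a]]|[chi]]]; last first.
- exact: dual_modular_of_modular.
- exact: dual_modular_of_right_adjoint a.
(* In the opposite string, a left adjoint of L is a right adjoint of the
   functor in the place of R, and the last isomorphism that it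
   satisfies reads R ≅ L(- ⊗ G) in terms of the original string. *)
have [G [_ _ _ r]] :=
  @dual_modular_of_right_adjoint (op_string T) _ (op_adjunction a).
apply: (@dual_modular_of_modular T G).
apply: nat_iso_op; case: r => e e_nat; exists e => V W f.
exact: e_nat.
Qed.

(** Both symmetries at once: the opposite exchanges R with L, the reversal
    exchanges the two sides of the tensor product. *)
Lemma right_ltens_inj (T : adjoint_string) (A B : st_D T) :
  nat_isomorphic (fcomp (st_R T) (ltens A)) (fcomp (st_R T) (ltens B)) ->
  isomorphic A B.
Proof.
move=> [e e_nat].
have [i] : @isomorphic (op (st_D T)) A B.
  apply: (@left_rtens_inj (op_string (rev_string T))).
  exists (fun V => op_iso (e V)) => V W f /=.
  exact/esym/(iso_square_inv (e_nat _ _ f)).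
by constructor; apply: unop_iso.
Qed.

Definition rcat_of (k : fieldType) (C : tensor_category k) : rcat :=
  RCat (tc_rigid C).

Definition strong_monoidal_of (k : fieldType) (C D : tensor_category k)
    (F : tensor_functor C D) : @strong_monoidal (rcat_of C) (rcat_of D) F :=
  @StrongMonoidal (rcat_of C) (rcat_of D) F (tf_mul F) (tf_unit F)
    (@tf_mul_nat _ _ _ F) (@tf_mul_assoc _ _ _ F) (@tf_mul_unitl _ _ _ F)
    (@tf_mul_unitr _ _ _ F).

Theorem proposition4p6 (k : fieldType) (C D : tensor_category k)
    (F : tensor_functor C D) (L R : functor D C)
    (adjLF : adjunction L F) (adjFR : adjunction F R)
    (hF : has_left_adjoint L \/ has_right_adjoint R \/
          exists chi : D, nat_isomorphic R (fcomp L (tensr chi))) :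
  (exists chiF : D, is_relative_modular_object L R chiF) /\
  forall chiF : D, is_relative_modular_object L R chiF ->
    [/\ nat_isomorphic (fcomp L (tensr chiF)) R,
        nat_isomorphic R (fcomp L (tensl chiF)),
        nat_isomorphic (fcomp R (tensl (chiF ^*))) L &
        nat_isomorphic L (fcomp R (tensr (chiF ^*)))] /\
    forall chi : D,
      [\/ nat_isomorphic (fcomp L (tensr chi)) R,
          nat_isomorphic R (fcomp L (tensl chi)),
          nat_isomorphic (fcomp R (tensl (chi ^*))) L |
          nat_isomorphic L (fcomp R (tensr (chi ^*)))] ->
      isomorphic chi chiF.
Proof.
pose T := AdjointString (strong_monoidal_of F) adjLF adjFR.
have [G mG] : exists G : st_D T, dual_modular G := @dual_modular_exists T hF.
have ii := dual_modular_duals_isomorphic mG.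
case: mG => Rl Rr Ll Lr.
split=> [|chiF RchiF]; first by exists (right_dual (tc_rigid D) G).
have ir : isomorphic chiF (right_dual (tc_rigid D) G) :=
  @left_rtens_inj T _ _ (nat_trans (nat_sym RchiF) Rr).
have il : isomorphic chiF (left_dual (tc_rigid D) G) := isomorphic_trans ir ii.
have ig : isomorphic (chiF ^*) G.
  exact: (@left_dual_isomorphic (rcat_of D) _ _ _ _ (left_duality _ _)
    (right_duality _ _)) ir.
have unstar (chi : D) : isomorphic (chi ^*) G -> isomorphic chi chiF.
  move=> ic; apply: isomorphic_trans (isomorphic_sym ir).
  exact: (@right_dual_isomorphic (rcat_of D) _ _ _ _ (left_duality _ _)
    (right_duality _ _)) ic.
split.
  split; first exact: nat_sym.
  - exact: nat_trans Rl (@nat_ltens C (rcat_of D) L _ _ (isomorphic_sym il)).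
  - exact: nat_trans (@nat_ltens C (rcat_of D) R _ _ ig) (nat_sym Ll).
  - exact: nat_trans Lr (@nat_rtens C (rcat_of D) R _ _ (isomorphic_sym ig)).
move=> chi [] e.
- exact: (@left_rtens_inj T _ _ (nat_trans e RchiF)).
- apply: isomorphic_trans (isomorphic_sym il).
  exact: (@left_rtens_inj (rev_string T) _ _ (nat_trans (nat_sym e) Rl)).
- apply: unstar; exact: (@right_ltens_inj T _ _ (nat_trans e Ll)).
- apply: unstar.
  exact: (@right_ltens_inj (rev_string T) _ _ (nat_trans (nat_sym e) Lr)).
Qed.
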